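(* Let $X$ be a nonelementary geodesically complete tree and let $X'$ be an arbitrary tree with $|\partial_\infty X'|\ge 3$. Then for any Möbius embedding $f:(\partial_\infty X,\mathcal{M}_X)\to(\partial_\infty X',\mathcal{M}_{X'})$ there exists a unique isometric embedding $F:X\to X'$ such that the extension of $F$ to the boundary coincides with $f$. If $f$ is in addition surjective and $X'$ is geodesically complete, then $F$ is an isometry.
   Context: **Trees.** A tree is a metric space $(X,d)$, $|xy|:=d(x,y)$, such that (1) any $x,y\in X$ are joined by a unique isometric map $c:[0,d(x,y)]\to X$ with $c(0)=x$, $c(d(x,y))=y$, with image denoted $[x,y]$; (2) if $[x,y]\cap[y,z]=\{y\}$ then $[x,z]=[x,y]\cup[y,z]$. It is geodesically complete if every isometric map $[0,\ell]\to X$, $\ell>0$, extends to an isometric map $\mathbb{R}\to X$. Isometric maps and isometric embeddings are distance-preserving maps, not necessarily surjective; an isometry is a surjective isometric embedding. **Boundary.** For $x,y,o\in X$ let $(x|y)_o=\frac12(|ox|+|oy|-|xy|)$. A sequence $(x_i)$ in $X$ is a Gromov sequence if $(x_i|x_j)_o\to\infty$ as $i,j\to\infty$ (for some base point $o\in X$); two Gromov sequences are equivalent if $(x_i|y_i)_o\to\infty$. $\partial_\infty X$ is the set of equivalence classes. $X$ is nonelementary if $|\partial_\infty X|\ge3$. An isometric embedding $F:X\to X'$ of trees extends to a map $\partial_\infty X\to\partial_\infty X'$ sending the class of $(x_i)$ to the class of $(F(x_i))$. For $a\ne b$ in $\partial_\infty X$ let $(a|b)_x=\lim_i(a_i|b_i)_x$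 for sequences $(a_i),(b_i)$ representing $a,b$ (well defined). The Bourdon metric at $x\in X$ is $\rho_x(a,b)=e^{-(a|b)_x}$ for $a\neq b$, $\rho_x(a,a)=0$; it is a metric on $\partial_\infty X$. **Möbius structure.** A quadruple $(a,b,c,e)$ of points of a set is admissible if no entry occurs three or four times. For a metric $\rho$ its cross ratio triple is $$\mathrm{crt}_\rho(a,b,c,e)=(\rho(a,b)\rho(c,e):\rho(a,c)\rho(b,e):\rho(a,e)\rho(b,c))\in\mathbb{R}P^2 .$$ Two metrics on the same set are Möbius equivalent if they have the same cross ratio triple on all admissible quadruples. All Bourdon metrics $\rho_x$, $x\in X$, are Möbius equivalent; $\mathcal{M}_X$ (the canonical Möbius structure) denotes their Möbius equivalence class. A Möbius map, or Möbius embedding, $f:(\partial_\infty X,\mathcal{M}_X)\to(\partial_\infty X',\mathcal{M}_{X'})$ is an injective map with $\mathrm{crt}_{\rho'}(f(a),f(b),f(c),f(e))=\mathrm{crt}_{\rho}(a,b,c,e)$ for all admissible quadruples, where $\rho$ is any Bourdon metric of $X$ and $\rho'$ any Bourdon metric of $X'$. *)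

(* Defs.v *)
From HB Require Import structures.
From mathcomp Require Import all_boot all_order all_algebra.
From mathcomp Require Import all_classical all_reals all_analysis.

Set Implicit Arguments.
Unset Strict Implicit.
Unset Printing Implicit Defensive.

Import Order.TTheory GRing.Theory Num.Theory.
Import numFieldNormedType.Exports.

Local Open Scope classical_set_scope.
Local Open Scope ring_scope.
Local Open Scope card_scope.

Section MetricSpaces.
Context {R : realType}.

Definition isometric_embedding {X X' : metricType R} (F : X -> X') : Prop :=
  forall x y, mdist (F x) (F y) = mdist x y.

Definition is_isometry {X X' : metricType R} (F : X -> X') : Prop :=
  isometric_embedding F /\ set_surj [set: X] [set: X'] F.

Context {X : metricType R}.

(* Maps defined on a subset of the real line are total functions of which only
   the values on that subset matter. *)
Definition isometric_on (D : set R) (c : R -> X) : Prop :=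
  forall s t, D s -> D t -> mdist (c s) (c t) = `|s - t|.

Definition geodesic (x y : X) (c : R -> X) : Prop :=
  [/\ isometric_on `[0, mdist x y] c, c 0 = x & c (mdist x y) = y].

Definition segment (x y : X) : set X :=
  [set z | exists2 c, geodesic x y c & (c @` `[0, mdist x y]) z].

End MetricSpaces.

Section Trees.
Context {R : realType}.

Definition is_tree (X : metricType R) : Prop :=
  (forall x y : X, exists2 c, geodesic x y c &
     forall c', geodesic x y c' -> {in `[0, mdist x y], c' =1 c}) /\
  (forall x y z : X, segment x y `&` segment y z = [set y] ->
     segment x z = segment x y `|` segment y z).

Definition geodesically_complete (X : metricType R) : Prop :=
  forall (l : R) (c : R -> X), 0 < l -> isometric_on `[0, l] c ->
    exists2 c' : R -> X, isometric_on [set: R] c' & {in `[0, l], c' =1 c}.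

End Trees.

Section Boundary.
Context {R : realType} {X : metricType R}.

Definition gromov_product (o x y : X) : R :=
  (mdist o x + mdist o y - mdist x y) / 2.

Definition gromov_seq (s : nat -> X) : Prop :=
  exists o : X,
    gromov_product o (s ij.1) (s ij.2) @[ij --> filter_prod \oo \oo] --> +oo.

Definition gromov_equiv (s t : nat -> X) : Prop :=
  exists o : X, gromov_product o (s i) (t i) @[i --> \oo] --> +oo.

Definition gromov_class (s : nat -> X) : set (nat -> X) :=
  [set t | gromov_seq t /\ gromov_equiv s t].

End Boundary.

Section BoundaryMoebius.
Context {R : realType}.

Definition boundary (X : metricType R) : Type :=
  set_type [set A : set (nat -> X) |
    exists2 s, gromov_seq s & A = gromov_class s].

Definition nonelementary (X : metricType R) : Prop :=
  `I_3 #<= [set: boundary X].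

(* [f] is the boundary extension of [F]: it sends the class of [s] to the class
   of [F \o s]. *)
Definition boundary_extension {X X' : metricType R} (F : X -> X')
    (f : boundary X -> boundary X') : Prop :=
  forall (a : boundary X) (s : nat -> X), gromov_seq s ->
    val a = gromov_class s -> val (f a) = gromov_class (F \o s).

(* The common limit of [(a_i|b_i)_x] over all sequences representing [a] and
   [b]; meaningful only when [X] is a tree and [a <> b]. *)
Definition boundary_gromov_product {X : metricType R} (x : X)
    (a b : boundary X) : R :=
  get [set l : R | forall s t : nat -> X, val a s -> val b t ->
    gromov_product x (s i) (t i) @[i --> \oo] --> l].

Definition bourdon {X : metricType R} (x : X) (a b : boundary X) : R :=
  if `[< a = b >] then 0 else expR (- boundary_gromov_product x a b).

Definition admissible {Z : Type} (a b c e : Z) : Prop :=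
  [/\ ~ (a = b /\ b = c), ~ (a = b /\ b = e), ~ (a = c /\ c = e)
    & ~ (b = c /\ c = e)].

(* The point [(x : y : z)] of the real projective plane, as the set of its
   homogeneous coordinates. *)
Definition projective_point (x y z : R) : set (R * R * R) :=
  [set v | exists2 k : R, k != 0 & v = (k * x, k * y, k * z)].

Definition crt {Z : Type} (rho : Z -> Z -> R) (a b c e : Z) :
    set (R * R * R) :=
  projective_point (rho a b * rho c e) (rho a c * rho b e)
    (rho a e * rho b c).

Definition moebius_embedding {X X' : metricType R}
    (f : boundary X -> boundary X') : Prop :=
  injective f /\
  forall (x : X) (x' : X') (a b c e : boundary X), admissible a b c e ->
    crt (bourdon x') (f a) (f b) (f c) (f e) = crt (bourdon x) a b c e.

End BoundaryMoebius.

(* Main.v *)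
Require Import Defs.
From mathcomp Require Import all_boot all_order all_algebra.
From mathcomp Require Import all_classical all_reals all_analysis.
From mathcomp Require Import lra.

(** Write [(a|b)_x] for the Gromov product of two boundary points seen from [x].
    The Bourdon metric at [x] is [exp (- (a|b)_x)], so the theorem says that the
    points of a geodesically complete tree can be recovered from their Bourdon
    metrics, and that a Moebius embedding [f] carries Bourdon metrics to Bourdon
    metrics.

    Trees are first reduced to three metric facts: every triangle is a tripod
    ([tree_median]), a point of a segment is determined by its distance to one
    end ([tree_point_uniq]), and Gromov products are ultrametric
    ([gromov_product_ultra]).  The last one makes the product of two sequences
    that converge to distinct boundary points eventually constant ([bgp_near]),
    so that limits are replaced by equalities valid for all large indices.

    Given three boundary points [a], [b], [c], the point [x] lies on the line
    from [a] to [b] iff [(a|b)_x = 0], and then [(a|c)_x - (b|c)_x] is an arc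
    length parameter on this line ([bgp_line_dist]); every value of the
    parameter is attained ([bgp_point_exists]).

    The main step is [moebius_point]: for every [x] in [X] there is [x'] in [X']
    such that [(fd|fe)_x' = (d|e)_x] for all [d <> e].  By geodesic completeness
    [x] lies on a line from some [a] to some [b]; pick a third point [c] and let
    [x'] be the point in the same position on the line from [fa] to [fb],
    relative to [fc].  The defect [g(d,e) = (fd|fe)_x' - (d|e)_x] vanishes on
    the pairs formed by [a], [b], [c].  Invariance of the cross ratio says that
    [g(p,q) + g(r,s)] does not depend on how four points are paired, hence
    [g(a,d) = g(b,d)] for every [d].  Since [(a|b)_x = 0], one of [(a|d)_x] and
    [(b|d)_x] vanishes, and likewise in [X'], whence [g(a,d) = g(b,d) = 0], and
    a second use of the invariance gives [g = 0].

    Put [F x = x'].  Two points of [X] lie on a common line, where distances are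
    differences of parameters, so [F] is isometric; it also preserves Busemann
    functions, which gives the boundary extension.  Conversely an isometric
    embedding that extends [f] satisfies the same identities
    ([isometric_extension_compatible]), and these determine [x'], so [F] is
    unique.  If [f] is onto and [X'] is geodesically complete, [moebius_point]
    for the inverse of [f] provides a preimage of every point of [X']. *)

Set Implicit Arguments.
Unset Strict Implicit.
Unset Printing Implicit Defensive.

Import Order.TTheory GRing.Theory Num.Theory.
Import numFieldNormedType.Exports.

Local Open Scope classical_set_scope.
Local Open Scope ring_scope.

(** [bgp x a b] is the product [(a|b)_x] of two boundary points. *)
Local Notation bgp := boundary_gromov_product.

(** * Geodesics *)

Section Geodesics.
Context {R : realType} {X : metricType R}.
Implicit Types (x y z p q : X) (c : R -> X).

Lemma geodesic_dist x y c t : geodesic x y c -> 0 <= t <= mdist x y ->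
  mdist x (c t) = t /\ mdist (c t) y = mdist x y - t.
Proof.
move=> [iso c0 cl] /andP[t0 tl]; have l0 : 0 <= mdist x y by lra.
split.
  rewrite -{1}c0 iso /= ?in_itv /= ?lexx ?t0 //.
  by rewrite sub0r normrN ger0_norm.
rewrite -{1}cl iso /= ?in_itv /= ?lexx ?t0 ?l0 //.
by rewrite distrC ger0_norm // subr_ge0.
Qed.

Lemma geodesic_suffix x y c a : geodesic x y c -> 0 <= a <= mdist x y ->
  geodesic (c a) y (fun u => c (a + u)).
Proof.
move=> gc ha; have [_ dy] := geodesic_dist gc ha.
have [iso c0 cl] := gc; split; rewrite ?dy ?addr0 //; last first.
  by rewrite addrC subrK.
move=> s t /=; rewrite !in_itv /= => hs ht.
rewrite iso /= ?in_itv /=; [|lra..].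
by congr (`| _ |); lra.
Qed.

Lemma geodesic_rev x y c : geodesic x y c ->
  geodesic y x (fun u => c (mdist x y - u)).
Proof.
move=> [iso c0 cl]; split; rewrite ?(metric_sym y x) ?subr0 ?subrr //.
move=> s t /=; rewrite !in_itv /= => hs ht.
rewrite iso /= ?in_itv /=; [|lra..].
by rewrite distrC; congr (`| _ |); lra.
Qed.

Lemma geodesic_segment x y c t : geodesic x y c -> 0 <= t <= mdist x y ->
  segment x y (c t).
Proof. by move=> gc ht; exists c => //; exists t; rewrite //= in_itv. Qed.

Lemma segment_dist x y z : segment x y z -> mdist x z + mdist z y = mdist x y.
Proof.
move=> [c gc [t]]; rewrite /= in_itv /= => ht <-.
by have [-> ->] := geodesic_dist gc ht; lra.
Qed.

End Geodesics.

(** * Trees as metric spaces *)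

Section Trees.
Context {R : realType} {X : metricType R} (hX : is_tree X).
Implicit Types (x y z p q o : X) (c : R -> X).

Lemma tree_geodesic x y : exists c, geodesic x y c.
Proof. by have [c gc _] := hX.1 x y; exists c. Qed.

Lemma tree_geodesic_uniq x y c c' t : geodesic x y c -> geodesic x y c' ->
  0 <= t <= mdist x y -> c t = c' t.
Proof.
have [c1 _ uniq] := hX.1 x y => gc gc' ht.
by rewrite (uniq _ gc) ?(uniq _ gc') // in_itv.
Qed.

(** Every triangle is a tripod: [m] is the point at which the geodesics from
    [x] to [y] and from [x] to [z] part. *)
Lemma tree_median x y z : exists m, [/\ segment x y m,
  mdist x m + mdist m y = mdist x y, mdist x m + mdist m z = mdist x z &
  mdist y m + mdist m z = mdist y z].
Proof.
have [c1 g1] := tree_geodesic x y; have [c2 g2] := tree_geodesic x z.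
pose T := [set t | [/\ 0 <= t <= mdist x y, 0 <= t <= mdist x z & c1 t = c2 t]].
have [dxy0 dxz0] := (mdist_ge0 x y, mdist_ge0 x z).
have T0 : T 0.
  by split; rewrite ?lexx ?dxy0 ?dxz0 //; case: g1 g2 => _ -> _ [_ -> _].
have supT : has_sup T.
  split; first by exists 0.
  by exists (mdist x y) => t [/andP[_ ->]].
pose t0 := sup T.
have t0ub t : T t -> t <= t0 by apply: sup_upper_bound.
have t0_ge0 : 0 <= t0 by exact: t0ub.
have t0xy : t0 <= mdist x y by apply: ge_sup => [|t [/andP[_ ->]]//]; exists 0.
have t0xz : t0 <= mdist x z.
  by apply: ge_sup => [|t [_ /andP[_ ->]]//]; exists 0.
have h1 : 0 <= t0 <= mdist x y by rewrite t0_ge0.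
have h2 : 0 <= t0 <= mdist x z by rewrite t0_ge0.
(* the supremum is attained, as both geodesics are continuous *)
have Tt0 : T t0.
  split=> //; apply: mdist_positivity; apply/eqP.
  rewrite eq_le mdist_ge0 andbT; apply/ler_addgt0Pl => e e0; rewrite addr0.
  have [//|t Tt lt_t] := @sup_adherent R T (e / 2) _ supT; first lra.
  have tle := t0ub _ Tt; case: Tt => t1 t2 ct; rewrite -/t0 in lt_t.
  have := metric_triangle (c1 t0) (c1 t) (c2 t0); rewrite {2}ct.
  case: g1 => iso1 _ _; case: g2 => iso2 _ _.
  rewrite iso1 /= ?in_itv //= iso2 /= ?in_itv //=.
  by rewrite ger0_norm ?ler0_norm; lra.
pose p := c1 t0; have pE : p = c2 t0 by case: Tt0.
have [dxp dpy] := geodesic_dist g1 h1; rewrite -/p in dxp dpy.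
have [_ dpz] := geodesic_dist g2 h2; rewrite -pE in dpz.
have gyp := geodesic_rev (geodesic_suffix g1 h1); rewrite -/p /= dpy in gyp.
have gpz := geodesic_suffix g2 h2; rewrite -pE in gpz.
have dyp : mdist y p = mdist x y - t0 by rewrite metric_sym.
have syp : segment y p p.
  have := geodesic_segment (t := mdist y p) gyp.
  by rewrite mdist_ge0 lexx dyp subrr addr0; apply.
have spz : segment p z p.
  have := geodesic_segment (t := 0) gpz.
  by rewrite lexx mdist_ge0 addr0 -pE; apply.
(* a common point of these segments lies on both geodesics from [x], at the
   same distance from [x], hence not beyond [t0] *)
have I : segment y p `&` segment p z = [set p].
  apply/seteqP; split=> [q [[c gc [u]]]|q ->]; last first.
    by split; [exact: syp | exact: spz].
  rewrite /= in_itv /= => hu <- {q} [c' gc' [v]].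
  rewrite /= in_itv /= => hv E.
  rewrite (tree_geodesic_uniq gc gyp) // in E *.
  rewrite (tree_geodesic_uniq gc' gpz) // in E.
  rewrite dyp in hu; rewrite dpz in hv.
  have [|d1 _] := geodesic_dist (t := t0 + (mdist x y - t0 - u)) g1; first lra.
  have [|d2 _] := geodesic_dist (t := t0 + v) g2; first lra.
  have E' : t0 + (mdist x y - t0 - u) = t0 + v by rewrite -d1 -d2 E.
  have : T (t0 + v).
    by split; [lra | lra | rewrite -{1}E' E].
  by move/t0ub => v0; congr (c1 _); lra.
have U := hX.2 _ _ _ I.
have /segment_dist S : segment y z p.
  by rewrite U; left.
exists p; split=> //; [|lra..].
exact: geodesic_segment g1 h1.
Qed.

Lemma tree_segmentP x y p :
  segment x y p <-> mdist x p + mdist p y = mdist x y.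
Proof.
split=> [|h]; first exact: segment_dist.
have [m [sm e1 e2 e3]] := tree_median x y p.
suff -> : p = m by [].
apply: mdist_positivity; move: h e1 e2 e3.
by rewrite !(metric_sym _ p) (metric_sym y m); lra.
Qed.

Lemma tree_point_exists x y t : 0 <= t <= mdist x y ->
  exists p, mdist x p = t /\ mdist p y = mdist x y - t.
Proof.
have [c gc] := tree_geodesic x y => ht.
by exists (c t); exact: geodesic_dist.
Qed.

Lemma tree_point_uniq x y p q : mdist x p + mdist p y = mdist x y ->
  mdist x q + mdist q y = mdist x y -> mdist x p = mdist x q -> p = q.
Proof.
move=> /tree_segmentP[c gc [t]] /= + <- /tree_segmentP[c' gc' [t']] /= + <-.
rewrite !in_itv /= => ht ht'.
have [-> _] := geodesic_dist gc ht; have [-> _] := geodesic_dist gc' ht'.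
by move=> <-; exact: tree_geodesic_uniq ht.
Qed.

Lemma gromov_product_sym o x y : gromov_product o x y = gromov_product o y x.
Proof. by rewrite /gromov_product (metric_sym x) (addrC (mdist o x)). Qed.

Lemma gromov_product_ge0 o x y : 0 <= gromov_product o x y.
Proof.
have := metric_triangle x o y; rewrite (metric_sym x o) /gromov_product; lra.
Qed.

Lemma gromov_product_le o x y : gromov_product o x y <= mdist o x.
Proof. have := metric_triangle o x y; rewrite /gromov_product; lra. Qed.

(** Up to distance [(x|y)_o] from [o], the geodesics from [o] to [x] and to [y]
    coincide. *)
Lemma gromov_product_point o x y p t : mdist o p = t ->
  mdist p x = mdist o x - t -> t <= gromov_product o x y ->
  mdist p y = mdist o y - t.
Proof.
move=> op px ht.
have [m [_ e1 e2 e3]] := tree_median o x y.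
have := mdist_ge0 o p; rewrite op => t0.
move: ht; rewrite /gromov_product -e1 -e2 -e3 (metric_sym x m) => ht.
have [|q [oq qm]] := @tree_point_exists o m t; first lra.
have := metric_triangle q m x; have := metric_triangle q m y.
have := metric_triangle o q x; have := metric_triangle o q y => *.
by rewrite (@tree_point_uniq o x p q); lra.
Qed.

(** The ultrametric inequality for Gromov products: trees are 0-hyperbolic. *)
Lemma gromov_product_ultra o x y z t : t <= gromov_product o x z ->
  t <= gromov_product o z y -> t <= gromov_product o x y.
Proof.
move=> txz tzy; have [t0|t0] := leP 0 t; last first.
  by have := gromov_product_ge0 o x y; lra.
have := gromov_product_le o z y => dz.
have [|p [op pz]] := @tree_point_exists o z t; first by lra.
have := @gromov_product_point o z x p t op pz.
rewrite gromov_product_sym => /(_ txz) px.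
have py := @gromov_product_point o z y p t op pz tzy.
have := metric_triangle x p y; rewrite (metric_sym x p) /gromov_product; lra.
Qed.

(** On a segment the distance to one end is an arc length parameter. *)
Lemma tree_line_dist x y p q : mdist x p + mdist p y = mdist x y ->
  mdist x q + mdist q y = mdist x y -> mdist p q = `|mdist x p - mdist x q|.
Proof.
wlog le : p q / mdist x p <= mdist x q => [H hp hq|hp hq].
  have [le|/ltW le] := leP (mdist x p) (mdist x q); first exact: H.
  by rewrite metric_sym distrC; exact: H.
have [|r [xr rq]] := @tree_point_exists x q (mdist x p).
  by rewrite mdist_ge0.
have := metric_triangle r q y; have := metric_triangle x r y => *.
rewrite (@tree_point_uniq x y p r); [|lra..].
by rewrite rq xr ler0_norm; lra.
Qed.

End Trees.

(** * Gromov sequences and boundary points *)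

Section GromovSequences.
Context {R : realType} {X : metricType R}.
Implicit Types (x y o p : X) (s t u : nat -> X).

(** Changing the base point changes Gromov products by a bounded amount, so
    that the choice of the base point in [gromov_seq] and [gromov_equiv] is
    irrelevant. *)
Lemma gromov_product_base o p x y :
  gromov_product o x y - mdist o p <= gromov_product p x y.
Proof.
have := metric_triangle o p x; have := metric_triangle o p y.
rewrite /gromov_product; lra.
Qed.

Lemma gromov_seqP s : gromov_seq s <-> forall o M, exists N, forall i j,
  (N <= i)%N -> (N <= j)%N -> M <= gromov_product o (s i) (s j).
Proof.
split=> [[x0 /cvgryPge H] p M|H].
  have [[A B] /= [[n1 _ h1] [n2 _ h2]] h] := H (M + mdist x0 p).
  exists (maxn n1 n2) => i j; rewrite !geq_max => /andP[i1 _] /andP[_ j2].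
  have := h (i, j) (conj (h1 i i1) (h2 j j2)).
  have := gromov_product_base x0 p (s i) (s j); rewrite /=; lra.
exists (s 0%N); apply/cvgryPge => M; have [N HN] := H (s 0%N) M.
exists ([set i | (N <= i)%N], [set i | (N <= i)%N]); first by split; exists N.
by move=> [i j] /= [hi hj]; exact: HN.
Qed.

Lemma gromov_equivP s t : gromov_equiv s t <->
  forall o M, \forall i \near \oo, M <= gromov_product o (s i) (t i).
Proof.
split=> [[x0 /cvgryPge H] p M|H]; last by exists (s 0%N); apply/cvgryPge.
apply: filterS (H (M + mdist x0 p)) => i hi.
have := gromov_product_base x0 p (s i) (t i); lra.
Qed.

Lemma not_gromov_equiv s t o : ~ gromov_equiv s t ->
  exists M, forall N, exists2 i, (N <= i)%N & gromov_product o (s i) (t i) < M.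
Proof.
move=> ne; apply: contrapT => H; apply: ne; exists o; apply/cvgryPge => M.
apply: contrapT => nM; apply: H; exists M => N.
apply: contrapT => nN; apply: nM; exists N => // i /= hi.
by rewrite leNgt; apply/negP => lt; apply: nN; exists i.
Qed.

Lemma gromov_equiv_refl s : gromov_seq s -> gromov_equiv s s.
Proof.
move=> /gromov_seqP H; apply/gromov_equivP => o M.
by have [N HN] := H o M; exists N => // i hi; exact: HN.
Qed.

Lemma gromov_equiv_sym s t : gromov_equiv s t -> gromov_equiv t s.
Proof.
move=> /gromov_equivP H; apply/gromov_equivP => o M.
by apply: filterS (H o M) => i; rewrite gromov_product_sym.
Qed.

Lemma boundary_val_seq (a : boundary X) s : val a s -> gromov_seq s.
Proof. by have /set_mem[s0 _ ->] := valP a; case. Qed.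

Lemma boundary_rep (a : boundary X) : exists s, val a s.
Proof.
have /set_mem[s hs ->] := valP a; exists s.
by split=> //; exact: gromov_equiv_refl.
Qed.

Lemma boundary_of_seq s : gromov_seq s ->
  exists2 a : boundary X, val a = gromov_class s & val a s.
Proof.
move=> hs; have H : gromov_class s \in [set A : set (nat -> X) |
    exists2 s, gromov_seq s & A = gromov_class s] by apply/mem_set; exists s.
exists (exist (fun A => A \in _) _ H) => //=; split=> //; exact: gromov_equiv_refl.
Qed.

End GromovSequences.

Section TreeBoundary.
Context {R : realType} {X : metricType R} (hX : is_tree X).
Implicit Types (x y o p : X) (s t u : nat -> X) (a b c : boundary X).

Lemma gromov_equiv_trans s t u :
  gromov_equiv s t -> gromov_equiv t u -> gromov_equiv s u.
Proof.
move=> /gromov_equivP H /gromov_equivP K; apply/gromov_equivP => o M.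
near=> i; apply: (gromov_product_ultra hX (z := t i)).
- by near: i; exact: H.
- by near: i; exact: K.
Unshelve. all: by end_near. Qed.

Lemma gromov_class_eq s t : gromov_equiv s t -> gromov_class s = gromov_class t.
Proof.
move=> st; apply/seteqP; split=> u [hu su]; split=> //.
  exact: gromov_equiv_trans (gromov_equiv_sym st) su.
exact: gromov_equiv_trans st su.
Qed.

Lemma boundary_val_class a s : val a s -> val a = gromov_class s.
Proof.
by have /set_mem[s0 _ ->] := valP a; case=> _ /gromov_class_eq.
Qed.

Lemma boundary_val_equiv a s t : val a s -> val a t -> gromov_equiv s t.
Proof. by move=> /boundary_val_class ->; case. Qed.

Lemma boundary_eq a b s t : val a s -> val b t -> gromov_equiv s t -> a = b.
Proof.
move=> /boundary_val_class ha /boundary_val_class hb st.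
by apply: val_inj; rewrite ha hb; exact: gromov_class_eq.
Qed.

Lemma boundary_val_cross a s t o M : val a s -> val a t ->
  exists N, forall i j, (N <= i)%N -> (N <= j)%N ->
    M <= gromov_product o (s i) (t j).
Proof.
move=> sa ta; have /gromov_seqP/(_ o M)[N1 h1] := boundary_val_seq sa.
have /gromov_equivP/(_ o M)[N2 _ h2] := boundary_val_equiv sa ta.
exists (maxn N1 N2) => i j; rewrite !geq_max => /andP[i1 i2] /andP[j1 j2].
by apply: (gromov_product_ultra hX (z := s j)); [exact: h1 | exact: h2].
Qed.

(** In a tree the Gromov products of sequences converging to two distinct
    boundary points are eventually constant, so that [(a|b)_x] is not only a
    limit but an eventual value. *)
Lemma bgp_near x a b s t : a <> b -> val a s -> val b t ->
  \forall i \near \oo, gromov_product x (s i) (t i) = bgp x a b.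
Proof.
move=> ab.
have [l Hl] : exists l, forall s t, val a s -> val b t ->
    \forall i \near \oo, gromov_product x (s i) (t i) = l.
  have [s0 a0] := boundary_rep a; have [t0 b0] := boundary_rep b.
  have /not_gromov_equiv-/(_ x)[M HM] : ~ gromov_equiv s0 t0.
    by move=> /(boundary_eq a0 b0).
  have /gromov_seqP/(_ x M)[N1 h1] := boundary_val_seq a0.
  have /gromov_seqP/(_ x M)[N2 h2] := boundary_val_seq b0.
  have [i0 + lt] := HM (maxn N1 N2); rewrite geq_max => /andP[i1 i2].
  (* products with [s0 i0] and [t0 i0] eventually exceed the smaller number
     [(s0 i0|t0 i0)_x], which is then the value of [(s i|t i)_x] *)
  exists (gromov_product x (s0 i0) (t0 i0)) => {}s {}t sa tb.
  have [N3 h3] := boundary_val_cross x M sa a0.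
  have [N4 h4] := boundary_val_cross x M tb b0.
  near=> i.
  have hs : M <= gromov_product x (s i) (s0 i0).
    apply: (gromov_product_ultra hX (z := s0 i)).
      by apply: h3; near: i; exact: nbhs_infty_ge.
    by apply: h1 => //; near: i; exact: nbhs_infty_ge.
  have ht : M <= gromov_product x (t i) (t0 i0).
    apply: (gromov_product_ultra hX (z := t0 i)).
      by apply: h4; near: i; exact: nbhs_infty_ge.
    by apply: h2 => //; near: i; exact: nbhs_infty_ge.
  apply/eqP; rewrite eq_le; apply/andP; split.
    rewrite leNgt; apply/negP => lt'.
    pose m := Num.min M (gromov_product x (s i) (t i)).
    have mM : m <= M by rewrite ge_min lexx.
    have mst : m <= gromov_product x (s i) (t i) by rewrite ge_min lexx orbT.
    suff : m <= gromov_product x (s0 i0) (t0 i0) by rewrite leNgt lt_min lt lt'.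
    apply: (gromov_product_ultra hX (z := s i)).
      by rewrite gromov_product_sym; exact: le_trans hs.
    by apply: (gromov_product_ultra hX (z := t i)) => //; exact: le_trans ht.
  apply: (gromov_product_ultra hX (z := s0 i0)); first lra.
  apply: (gromov_product_ultra hX (z := t0 i0)) => //.
  by rewrite (gromov_product_sym _ (t0 i0)); lra.
move=> sa tb; apply: filterS (Hl _ _ sa tb) => i ->.
have P : exists l : R, forall s t : nat -> X, val a s -> val b t ->
    gromov_product x (s i) (t i) @[i --> \oo] --> l.
  by exists l => s' t' sa' tb'; apply: cvg_near_cst; exact: Hl.
have := getPex P _ _ sa tb; rewrite -/(bgp x a b) => C.
apply: (cvg_unique (@norm_hausdorff _ _) _ C).
by apply: cvg_near_cst; exact: Hl.
Unshelve. all: by end_near. Qed.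

Lemma bgp_sym x a b : bgp x a b = bgp x b a.
Proof.
have [->//|/eqP ab] := eqVneq a b.
have [s sa] := boundary_rep a; have [t tb] := boundary_rep b.
near \oo => i.
have <- : gromov_product x (s i) (t i) = bgp x a b by near: i; exact: bgp_near.
have <- : gromov_product x (t i) (s i) = bgp x b a.
  by near: i; apply: bgp_near => // ba; exact: ab.
exact: gromov_product_sym.
Unshelve. all: by end_near. Qed.

Lemma bgp_ge0 x a b : a <> b -> 0 <= bgp x a b.
Proof.
move=> ab; have [s sa] := boundary_rep a; have [t tb] := boundary_rep b.
near \oo => i.
have <- : gromov_product x (s i) (t i) = bgp x a b by near: i; exact: bgp_near.
exact: gromov_product_ge0.
Unshelve. all: by end_near. Qed.

Lemma bgp_ultra x a b c m : a <> b -> b <> c -> a <> c ->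
  m <= bgp x a b -> m <= bgp x b c -> m <= bgp x a c.
Proof.
move=> ab bc ac.
have [s sa] := boundary_rep a; have [r rb] := boundary_rep b.
have [u uc] := boundary_rep c.
near \oo => i.
have <- : gromov_product x (s i) (r i) = bgp x a b by near: i; exact: bgp_near.
have <- : gromov_product x (r i) (u i) = bgp x b c by near: i; exact: bgp_near.
have <- : gromov_product x (s i) (u i) = bgp x a c by near: i; exact: bgp_near.
exact: gromov_product_ultra.
Unshelve. all: by end_near. Qed.

(** The effect on the products [(b|c)_x] of moving [x] by the distance [tau]
    along the ray towards [a]. *)
Lemma bgp_move x a tau : 0 <= tau -> exists y,
  (forall b, a <> b -> bgp y a b = bgp x a b - Num.min tau (bgp x a b)) /\
  (forall b c, a <> b -> a <> c -> b <> c -> bgp y b c = bgp x b c + tau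
     - Num.min tau (bgp x a b) - Num.min tau (bgp x a c)).
Proof.
move=> tau0; have [s sa] := boundary_rep a.
have /gromov_seqP/(_ x tau)[N HN] := boundary_val_seq sa.
have [|y [xy ysN]] := tree_point_exists hX (x := x) (y := s N) (t := tau).
  by rewrite tau0 (le_trans (HN N N _ _)) // gromov_product_le.
have ys i : (N <= i)%N -> mdist y (s i) = mdist x (s i) - tau.
  by move=> hi; apply: (gromov_product_point hX xy ysN); exact: HN.
have yt b t : a <> b -> val b t -> \forall i \near \oo,
    mdist y (t i) = mdist x (t i) + tau - 2 * Num.min tau (bgp x a b).
  move=> ab tb; near=> i.
  have ysi : mdist y (s i) = mdist x (s i) - tau.
    by apply: ys; near: i; exact: nbhs_infty_ge.
  have <- : gromov_product x (s i) (t i) = bgp x a b by near: i; exact: bgp_near.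
  have [le|lt] := leP tau (gromov_product x (s i) (t i)).
    by rewrite (gromov_product_point hX xy ysi) //; lra.
  have E : gromov_product x (s i) y = tau.
    by rewrite /gromov_product xy (metric_sym _ y) ysi; lra.
  suff : gromov_product x y (t i) = gromov_product x (s i) (t i).
    by rewrite /gromov_product xy; lra.
  apply/eqP; rewrite eq_le; apply/andP; split; last first.
    apply: (gromov_product_ultra hX (z := s i)) => //.
    by rewrite (gromov_product_sym x y) E; exact: ltW.
  rewrite leNgt; apply/negP => lt'.
  pose m := Num.min tau (gromov_product x y (t i)).
  suff : m <= gromov_product x (s i) (t i) by rewrite leNgt lt_min lt lt'.
  apply: (gromov_product_ultra hX (z := y)); rewrite ?E /m ge_min lexx //.
  by rewrite orbT.
exists y; split=> [b ab|b c ab ac bc].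
  have [t tb] := boundary_rep b; near \oo => i.
  have <- : gromov_product y (s i) (t i) = bgp y a b by near: i; exact: bgp_near.
  have E : gromov_product x (s i) (t i) = bgp x a b by near: i; exact: bgp_near.
  have : mdist y (t i) = mdist x (t i) + tau - 2 * Num.min tau (bgp x a b).
    by near: i; exact: yt.
  have : mdist y (s i) = mdist x (s i) - tau.
    by apply: ys; near: i; exact: nbhs_infty_ge.
  by move: E; rewrite /gromov_product; lra.
have [t tb] := boundary_rep b; have [u uc] := boundary_rep c; near \oo => i.
have <- : gromov_product y (t i) (u i) = bgp y b c by near: i; exact: bgp_near.
have E : gromov_product x (t i) (u i) = bgp x b c by near: i; exact: bgp_near.
have : mdist y (t i) = mdist x (t i) + tau - 2 * Num.min tau (bgp x a b).
  by near: i; exact: yt.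
have : mdist y (u i) = mdist x (u i) + tau - 2 * Num.min tau (bgp x a c).
  by near: i; exact: yt.
by move: E; rewrite /gromov_product; lra.
Unshelve. all: by end_near. Qed.

End TreeBoundary.

(** * Points of a tree seen from three boundary points *)

Section BoundaryPosition.
Context {R : realType} {X : metricType R} (hX : is_tree X).
Implicit Types (x y o p : X) (s t u : nat -> X) (a b c : boundary X).

(** By ultrametricity the two smallest of the three products of [a], [b], [c]
    agree.  If they are those of [a], moving by their common value towards [a]
    reaches the line from [b] to [a], and moving on towards [b] by what remains
    of [(b|c)] reaches the centre of the tripod spanned by [a], [b], [c]. *)
Lemma bgp_center_aux o a b c : a <> b -> a <> c -> b <> c ->
  bgp o a b = bgp o a c -> bgp o a b <= bgp o b c ->
  exists x, [/\ bgp x a b = 0, bgp x a c = 0 & bgp x b c = 0].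
Proof.
move=> ab ac bc e le; have ba : b <> a by move=> E; exact: ab.
have k0 := bgp_ge0 hX o ab.
have [y [y1 y2]] := bgp_move hX o a k0.
have yab : bgp y a b = 0 by rewrite y1 // minxx subrr.
have yac : bgp y a c = 0 by rewrite y1 // e minxx subrr.
have ybc : bgp y b c = bgp o b c - bgp o a b.
  by rewrite y2 // -e minxx; lra.
have t0 : 0 <= bgp y b c by rewrite ybc subr_ge0.
have [z [z1 z2]] := bgp_move hX y b t0.
exists z; split.
- by rewrite (bgp_sym hX) z1 // (bgp_sym hX) yab min_r // subrr.
- by rewrite z2 // yac (bgp_sym hX y b a) yab minxx min_r //; lra.
- by rewrite z1 // minxx subrr.
Qed.

Lemma bgp_center o a b c : a <> b -> a <> c -> b <> c ->
  exists x, [/\ bgp x a b = 0, bgp x a c = 0 & bgp x b c = 0].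
Proof.
move=> ab ac bc; have ba := nesym ab; have ca := nesym ac; have cb := nesym bc.
have u1 := bgp_ultra hX (x := o) ab bc ac.
have u2 := bgp_ultra hX (x := o) ac cb ab.
have u3 := bgp_ultra hX (x := o) ba ac bc.
rewrite (bgp_sym hX o b a) in u3; rewrite (bgp_sym hX o c b) in u2.
pose A := bgp o a b; pose B := bgp o a c; pose C := bgp o b c.
have : [\/ A = B /\ A <= C, A = C /\ A <= B | B = C /\ B <= A].
  have v1 := u1 (Num.min A C); have v2 := u2 (Num.min B C).
  have v3 := u3 (Num.min A B).
  rewrite !ge_min !lexx ?orbT in v1 v2 v3.
  move: (v1 isT isT) (v2 isT isT) (v3 isT isT).
  rewrite -/A -/B -/C => /orP w1 /orP w2 /orP w3.
  clear ab ac bc ba ca cb.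
  have [AB|AB] := leP A B; have [BC|BC] := leP B C; have [AC|AC] := leP A C;
  first [by apply: Or31; split; lra | by apply: Or32; split; lra
    | by apply: Or33; split; lra].
case=> -[e le].
- exact: bgp_center_aux e le.
- have [||x [xba xbc xac]] := @bgp_center_aux o b a c ba bc ac.
  + by rewrite (bgp_sym hX).
  + by rewrite (bgp_sym hX).
  by exists x; split; rewrite // (bgp_sym hX).
- have [||x [xca xcb xab]] := @bgp_center_aux o c a b ca cb ab.
  + by rewrite (bgp_sym hX) (bgp_sym hX _ c).
  + by rewrite (bgp_sym hX).
  by exists x; split; rewrite // (bgp_sym hX).
Qed.

(** On the line from [a] to [b] every position relative to [c] is taken.
    At a point [x] of this line at most one of [(a|c)_x] and [(b|c)_x] is
    nonzero; the larger one is the distance from [x] to the centre of the tripod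
    spanned by [a], [b], [c]. *)
Lemma bgp_point_exists o a b c P Q : a <> b -> a <> c -> b <> c ->
  0 <= P -> 0 <= Q -> P = 0 \/ Q = 0 ->
  exists x, [/\ bgp x a b = 0, bgp x a c = P & bgp x b c = Q].
Proof.
move=> ab ac bc P0 Q0 PQ; have ba := nesym ab.
have [m [mab mac mbc]] := bgp_center o ab ac bc.
case: PQ => ->.
  have [x [x1 x2]] := bgp_move hX m a Q0; exists x.
  by rewrite !x1 // x2 // mab mac mbc !min_r //; split; lra.
have [x [x1 x2]] := bgp_move hX m b P0; exists x.
rewrite (bgp_sym hX x a b) !x1 // x2 // (bgp_sym hX m b a) mab mac mbc.
by rewrite !min_r //; split; lra.
Qed.

(** The Busemann function of [a] in terms of products of boundary points. *)
Lemma bgp_busemann x y a b c s : a <> b -> a <> c -> b <> c -> val a s ->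
  \forall i \near \oo, mdist x (s i) - mdist y (s i) =
    (bgp x a b + bgp x a c - bgp x b c) - (bgp y a b + bgp y a c - bgp y b c).
Proof.
move=> ab ac bc sa.
have [t tb] := boundary_rep b; have [u uc] := boundary_rep c.
near=> i.
have <- : gromov_product x (s i) (t i) = bgp x a b by near: i; exact: bgp_near.
have <- : gromov_product x (s i) (u i) = bgp x a c by near: i; exact: bgp_near.
have <- : gromov_product x (t i) (u i) = bgp x b c by near: i; exact: bgp_near.
have <- : gromov_product y (s i) (t i) = bgp y a b by near: i; exact: bgp_near.
have <- : gromov_product y (s i) (u i) = bgp y a c by near: i; exact: bgp_near.
have <- : gromov_product y (t i) (u i) = bgp y b c by near: i; exact: bgp_near.
by rewrite /gromov_product; lra.
Unshelve. all: by end_near. Qed.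

(** [(a|b)_x = 0] says that [x] lies on the line from [a] to [b]; the difference
    [(a|c)_x - (b|c)_x] is an arc length parameter of this line. *)
Lemma bgp_line_dist x y a b c : a <> b -> a <> c -> b <> c ->
  bgp x a b = 0 -> bgp y a b = 0 ->
  mdist x y = `|(bgp x a c - bgp x b c) - (bgp y a c - bgp y b c)|.
Proof.
move=> ab ac bc x0 y0.
have [s sa] := boundary_rep a; have [t tb] := boundary_rep b.
near \oo => i.
have : gromov_product x (s i) (t i) = bgp x a b by near: i; exact: bgp_near.
have : gromov_product y (s i) (t i) = bgp y a b by near: i; exact: bgp_near.
rewrite x0 y0 /gromov_product => ey ex.
have -> : (bgp x a c - bgp x b c) - (bgp y a c - bgp y b c) =
    mdist (s i) x - mdist (s i) y.
  have : mdist x (s i) - mdist y (s i) = (bgp x a b + bgp x a c - bgp x b c) -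
      (bgp y a b + bgp y a c - bgp y b c) by near: i; exact: bgp_busemann.
  by rewrite x0 y0 !(metric_sym (s i)); lra.
by apply: (tree_line_dist hX (y := t i)); rewrite metric_sym; lra.
Unshelve. all: by end_near. Qed.

Lemma bgp_point_uniq x y a b c : a <> b -> a <> c -> b <> c ->
  bgp x a b = 0 -> bgp y a b = 0 -> bgp x a c = bgp y a c ->
  bgp x b c = bgp y b c -> x = y.
Proof.
move=> ab ac bc x0 y0 e1 e2; apply: mdist_positivity.
by rewrite (bgp_line_dist ab ac bc x0 y0) e1 e2 subrr normr0.
Qed.

End BoundaryPosition.

(** * Lines in geodesically complete trees *)

Section Lines.
Context {R : realType} {X : metricType R}.
Implicit Types (x y : X) (a b c : boundary X).

Lemma boundary_third (p q : boundary X) : nonelementary X ->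
  exists2 r, p <> r & q <> r.
Proof.
move=> /card_leP[g].
pose e k (hk : (k < 3)%N) : `I_3 := exist _ k (mem_set hk).
have inj k l hk hl : g (@e k hk) = g (@e l hl) -> k = l.
  by move=> /(@inj _ _ _ g)-/(_ (in_setT _) (in_setT _))[].
pose h k hk : boundary X := val (g (@e k hk)).
have hinj k l hk hl : h k hk = h l hl -> k = l by move=> /val_inj; exact: inj.
apply: contrapT => N.
have H k (hk : (k < 3)%N) : h k hk = p \/ h k hk = q.
  apply: contrapT => /not_orP[np nq]; apply: N.
  by exists (h k hk); exact: nesym.
have := @hinj 0%N 1%N isT isT; have := @hinj 0%N 2%N isT isT.
have := @hinj 1%N 2%N isT isT.
by case: (H 0%N isT) (H 1%N isT) (H 2%N isT) => -> [] -> [] -> h1 h2 h3;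
  try (by have := h1 erefl); try (by have := h2 erefl); by have := h3 erefl.
Qed.

Lemma isometric_line_gromov_seq (c : R -> X) : isometric_on [set: R] c ->
  gromov_seq (fun i => c i%:R).
Proof.
move=> iso; exists (c 0); apply/cvgryPge => M.
near \oo => N.
have MN : M <= N%:R by near: N; exact: nbhs_infty_ger.
exists ([set i | (N <= i)%N], [set i | (N <= i)%N]); first by split; exists N.
move=> [i j] /= [hi hj]; rewrite /gromov_product !iso // !sub0r !normrN.
have Ni : N%:R <= i%:R :> R by rewrite ler_nat.
have Nj : N%:R <= j%:R :> R by rewrite ler_nat.
have N0 : 0 <= N%:R :> R by rewrite ler0n.
rewrite !(ger0_norm (ler0n R _)).
have [le|/ltW le] := leP (i%:R : R) j%:R.
  by rewrite (@ler0_norm _ (i%:R - j%:R)); lra.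
by rewrite (@ger0_norm _ (i%:R - j%:R)); lra.
Unshelve. all: by end_near. Qed.

Hypotheses (hX : is_tree X) (hXc : geodesically_complete X).

(** In a geodesically complete tree two distinct points lie on a line. *)
Lemma line_through2 x y : x <> y ->
  exists a b, [/\ a <> b, bgp x a b = 0 & bgp y a b = 0].
Proof.
move=> xy; have l0 : 0 < mdist x y by rewrite mdist_gt0; apply/eqP.
have [c0 [iso0 c00 c0l]] := tree_geodesic hX x y.
have [c iso cE] := hXc l0 iso0.
have cx : c 0 = x by rewrite cE ?in_itv /= ?lexx ?ltW.
have cy : c (mdist x y) = y by rewrite cE ?in_itv /= ?lexx ?ltW.
have iso' : isometric_on [set: R] (fun r => c (- r)).
  by move=> s t _ _; rewrite iso // opprK addrC distrC.
have [a _ sa] := boundary_of_seq (isometric_line_gromov_seq iso').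
have [b _ tb] := boundary_of_seq (isometric_line_gromov_seq iso).
have gp0 r : \forall i \near \oo,
    gromov_product (c r) (c (- i%:R)) (c i%:R) = 0.
  near=> i.
  have : `|r| <= i%:R by near: i; exact: nbhs_infty_ger.
  rewrite ler_norml => /andP[r1 r2].
  rewrite /gromov_product !iso // opprK ger0_norm; last lra.
  rewrite ler0_norm; last lra.
  by rewrite ler0_norm; lra.
have ab : a <> b.
  move=> E; rewrite -E in tb.
  have /gromov_equivP/(_ (c 0) 1) H := boundary_val_equiv hX sa tb.
  near \oo => i.
  have : 1 <= gromov_product (c 0) (c (- i%:R)) (c i%:R) by near: i; exact: H.
  suff -> : gromov_product (c 0) (c (- i%:R)) (c i%:R) = 0 by lra.
  by near: i; exact: gp0.
have on r : bgp (c r) a b = 0.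
  near \oo => i.
  have <- : gromov_product (c r) (c (- i%:R)) (c i%:R) = bgp (c r) a b.
    by near: i; exact: (bgp_near hX _ ab sa tb).
  by near: i; exact: gp0.
by exists a, b; split=> //; [rewrite -cx | rewrite -cy].
Unshelve. all: by end_near. Qed.

Lemma line_through x : nonelementary X ->
  exists a b, a <> b /\ bgp x a b = 0.
Proof.
move=> /card_leP[g].
pose a0 : boundary X := val (g (exist _ 0%N (mem_set (isT : `I_3 0%N)))).
have [y xy] : exists y, x <> y.
  apply: contrapT => N.
  have E y : x = y by apply: contrapT => xy; apply: N; exists y.
  have [s /boundary_val_seq/gromov_seqP/(_ x 1)[n]] := boundary_rep a0.
  move=> /(_ n n (leqnn _) (leqnn _)).
  by rewrite -(E (s n)) /gromov_product mdistxx; lra.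
by have [a [b [ab xab _]]] := line_through2 xy; exists a, b.
Qed.

End Lines.

(** * Moebius embeddings *)

Section Moebius.
Context {R : realType} {X X' : metricType R}.
Hypotheses (hX : is_tree X) (hX' : is_tree X').
Implicit Types (x y : X) (a b c d e : boundary X).

(** Invariance of the cross ratio triple in logarithmic form: the defect [g] of
    [f], summed over the two pairs into which four distinct boundary points are
    split, does not depend on the pairing. *)
Lemma moebius_bgp (f : boundary X -> boundary X') x (x' : X') a b c e :
  moebius_embedding f ->
  a <> b -> a <> c -> a <> e -> b <> c -> b <> e -> c <> e ->
  let g p q := bgp x' (f p) (f q) - bgp x p q in
  g a b + g c e = g a c + g b e /\ g a b + g c e = g a e + g b c.
Proof.
move=> [finj fcrt] ab ac ae bc be ce g.
have adm : admissible a b c e by split=> -[].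
have B p q : p <> q -> bourdon x p q = expR (- bgp x p q).
  by move=> pq; rewrite /bourdon asboolF.
have B' p q : p <> q -> bourdon x' (f p) (f q) = expR (- bgp x' (f p) (f q)).
  by move=> pq; rewrite /bourdon asboolF // => /finj.
have := fcrt x x' a b c e adm; rewrite /crt !B // !B' // -!expRD => H.
have : projective_point (expR (- bgp x a b + - bgp x c e))
  (expR (- bgp x a c + - bgp x b e)) (expR (- bgp x a e + - bgp x b c))
  (expR (- bgp x a b + - bgp x c e), expR (- bgp x a c + - bgp x b e),
   expR (- bgp x a e + - bgp x b c)).
  by exists 1; rewrite ?oner_eq0 // !mul1r.
rewrite -H => -[k k0 [E1 E2 E3]].
have kp : 0 < k.
  have := expR_gt0 (- bgp x a b + - bgp x c e).
  by rewrite E1 pmulr_lgt0 // expR_gt0.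
rewrite -(lnK (x := k)) ?posrE // -!expRD in E1 E2 E3.
move: (expR_inj E1) (expR_inj E2) (expR_inj E3); rewrite /g; lra.
Qed.

(** The image of [x]: a Moebius embedding carries the Bourdon metric at [x] to
    the Bourdon metric at some point of [X']. *)
Lemma moebius_point (f : boundary X -> boundary X') x :
  geodesically_complete X -> nonelementary X -> moebius_embedding f ->
  exists x' : X', forall d e, d <> e -> bgp x' (f d) (f e) = bgp x d e.
Proof.
move=> hXc hX3 hf.
have [a [b [ab xab]]] := line_through hX hXc x hX3.
have [c ac bc] := boundary_third a b hX3.
have fne d e : d <> e -> f d <> f e by move=> de /(hf.1).
have [s _] := boundary_rep (f a).
(* [x] lies on the line from [a] to [b], hence at most one of the products of
   [d] with [a] and [b] is nonzero *)
have zero d : a <> d -> b <> d -> bgp x a d = 0 \/ bgp x b d = 0.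
  move=> ad bd; have := bgp_ge0 hX x ad; have := bgp_ge0 hX x bd => q0 p0.
  have U := bgp_ultra hX (x := x) ad (nesym bd) ab.
  have := U (Num.min (bgp x a d) (bgp x b d)).
  rewrite (bgp_sym hX x d b) !ge_min !lexx orbT xab => /(_ isT isT).
  by case/orP => h; [left | right]; lra.
have [x' [x'ab x'ac x'bc]] := bgp_point_exists hX' (s 0%N) (fne _ _ ab)
  (fne _ _ ac) (fne _ _ bc) (bgp_ge0 hX x ac) (bgp_ge0 hX x bc) (zero _ ac bc).
have zero' d : a <> d -> b <> d ->
    bgp x' (f a) (f d) = 0 \/ bgp x' (f b) (f d) = 0.
  move=> ad bd.
  have := bgp_ge0 hX' x' (fne _ _ ad); have := bgp_ge0 hX' x' (fne _ _ bd).
  move=> q0 p0.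
  have U := bgp_ultra hX' (x := x') (fne _ _ ad) (fne _ _ (nesym bd))
    (fne _ _ ab).
  have := U (Num.min (bgp x' (f a) (f d)) (bgp x' (f b) (f d))).
  rewrite (bgp_sym hX' x' (f d)) !ge_min !lexx orbT x'ab => /(_ isT isT).
  by case/orP => h; [left | right]; lra.
(* by invariance on [a], [b], [c], [d] the products of [d] with [a] and [b] have
   the same defect; as one of the two products vanishes, in [X] and in [X'], so
   does this defect *)
have key d : a <> d -> b <> d ->
    bgp x' (f a) (f d) = bgp x a d /\ bgp x' (f b) (f d) = bgp x b d.
  move=> ad bd; have [<-//|/eqP cd] := eqVneq c d.
  have [] := moebius_bgp x x' hf ab ac ad bc bd cd; rewrite x'ab x'ac x'bc xab.
  have := bgp_ge0 hX' x' (fne _ _ ad); have := bgp_ge0 hX' x' (fne _ _ bd).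
  have := bgp_ge0 hX x ad; have := bgp_ge0 hX x bd.
  by case: (zero d ad bd) (zero' d ad bd) => -> [] ->; lra.
exists x' => d e.
have [->|/eqP ad] := eqVneq d a.
  move=> ae; have [->|/eqP eb] := eqVneq e b; first by rewrite x'ab.
  by case: (key e ae (nesym eb)).
have [->|/eqP ae] := eqVneq e a.
  move=> da; rewrite (bgp_sym hX') (bgp_sym hX).
  have [->|/eqP eb] := eqVneq d b; first by rewrite x'ab.
  by case: (key d (nesym da) (nesym eb)).
have [->|/eqP bd] := eqVneq d b.
  by move=> be; case: (key e (nesym ae) be).
have [->|/eqP be] := eqVneq e b.
  move=> db; rewrite (bgp_sym hX') (bgp_sym hX).
  by case: (key d (nesym ad) (nesym db)).
move=> de.
have [+ _] := moebius_bgp x x' hf ab (nesym ad) (nesym ae) (nesym bd)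
  (nesym be) de.
have [-> _] := key d (nesym ad) (nesym bd).
have [_ ->] := key e (nesym ae) (nesym be).
by rewrite x'ab xab; lra.
Qed.

(** [F] is compatible with [f] if [f] carries the Bourdon metric at [x] to the
    one at [F x] for every [x]. *)
Definition bgp_compatible (f : boundary X -> boundary X') (F : X -> X') :=
  forall x d e, d <> e -> bgp (F x) (f d) (f e) = bgp x d e.

Lemma bgp_compatible_isometric f F : geodesically_complete X ->
  nonelementary X -> injective f -> bgp_compatible f F ->
  isometric_embedding F.
Proof.
move=> hXc hX3 finj hF x y; have [->|/eqP xy] := eqVneq x y.
  by rewrite !mdistxx.
have [a [b [ab xab yab]]] := line_through2 hX hXc xy.
have [c ac bc] := boundary_third a b hX3.
have fne d e : d <> e -> f d <> f e by move=> de /finj.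
rewrite (bgp_line_dist hX ab ac bc) // (bgp_line_dist hX' (fne _ _ ab)
  (fne _ _ ac) (fne _ _ bc)) ?hF //.
Qed.

Lemma isometric_gromov_seq (F : X -> X') (s : nat -> X) :
  isometric_embedding F -> gromov_seq s -> gromov_seq (F \o s).
Proof.
move=> hF [p /cvgryPge hp]; exists (F p); apply/cvgryPge => M.
by apply: filterS (hp M) => ij; rewrite /gromov_product /= !hF.
Qed.

Lemma bgp_compatible_extension f F : geodesically_complete X ->
  nonelementary X -> injective f -> bgp_compatible f F ->
  boundary_extension F f.
Proof.
move=> hXc hX3 finj hF a s hs as_.
have iso := bgp_compatible_isometric hXc hX3 finj hF.
have sa : val a s by rewrite as_; split=> //; exact: gromov_equiv_refl.
have fne d e : d <> e -> f d <> f e by move=> de /finj.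
have [b ab _] := boundary_third a a hX3.
have [c ac bc] := boundary_third a b hX3.
have [t ta] := boundary_rep (f a).
have hFs := isometric_gromov_seq iso hs.
(* the Busemann function of [f a] on the image of [F] is that of [a] *)
have gpE x o : \forall j \near \oo,
    gromov_product (F o) (F x) (t j) = gromov_product o x (s j).
  near=> j.
  have : mdist (F x) (t j) - mdist (F o) (t j) =
      mdist x (s j) - mdist o (s j).
    have -> : mdist x (s j) - mdist o (s j) =
      (bgp x a b + bgp x a c - bgp x b c) - (bgp o a b + bgp o a c - bgp o b c).
      by near: j; exact: bgp_busemann.
    rewrite -!hF //; near: j.
    by apply: (bgp_busemann hX' _ _ (fne _ _ ab) (fne _ _ ac) (fne _ _ bc) ta).
  by rewrite /gromov_product iso; lra.
have [b' b'E b's] := boundary_of_seq hFs.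
rewrite -b'E; congr (val _); apply: (boundary_eq hX' ta b's).
apply/gromov_equiv_sym; exists (F (s 0%N)); apply/cvgryPge => M.
have /gromov_seqP/(_ (s 0%N) M)[N1 h1] := hs.
have /gromov_seqP/(_ (F (s 0%N)) M)[N2 h2] := boundary_val_seq ta.
near=> i; near \oo => j.
apply: (gromov_product_ultra hX' (z := t j)).
  rewrite [leRHS](_ : _ = gromov_product (s 0%N) (s i) (s j)).
    apply: h1; first by near: i; exact: nbhs_infty_ge.
    by near: j; exact: nbhs_infty_ge.
  by near: j; exact: gpE.
apply: h2; first by near: j; exact: nbhs_infty_ge.
by near: i; exact: nbhs_infty_ge.
Unshelve. all: by end_near. Qed.

Lemma isometric_extension_compatible f F : injective f ->
  isometric_embedding F -> boundary_extension F f -> bgp_compatible f F.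
Proof.
move=> finj iso ext x d e de.
have [s sd] := boundary_rep d; have [t te] := boundary_rep e.
have im a u : val a u -> val (f a) (F \o u).
  move=> ua; rewrite (ext a u); last 2 first.
  - exact: boundary_val_seq ua.
  - exact: boundary_val_class ua.
  have hu := isometric_gromov_seq iso (boundary_val_seq ua).
  by split=> //; apply: gromov_equiv_refl.
near \oo => i.
have <- : gromov_product x (s i) (t i) = bgp x d e by near: i; exact: bgp_near.
have <- : gromov_product (F x) (F (s i)) (F (t i)) = bgp (F x) (f d) (f e).
  near: i; apply: (bgp_near hX' _ _ (im _ _ sd) (im _ _ te)).
  exact: contra_not (@finj d e) de.
by rewrite /gromov_product !iso.
Unshelve. all: by end_near. Qed.

(** A point of [X'] is determined by the products of the points in the image of
    [f], provided these products come from a point of [X]. *)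
Lemma bgp_ext_eq (f : boundary X -> boundary X') (x : X) (x1 x2 : X') :
  geodesically_complete X -> nonelementary X -> injective f ->
  (forall d e, d <> e -> bgp x1 (f d) (f e) = bgp x d e) ->
  (forall d e, d <> e -> bgp x2 (f d) (f e) = bgp x d e) -> x1 = x2.
Proof.
move=> hXc hX3 finj h1 h2.
have [a [b [ab xab]]] := line_through hX hXc x hX3.
have [c ac bc] := boundary_third a b hX3.
have fne d e : d <> e -> f d <> f e by move=> de /finj.
by apply: (bgp_point_uniq hX' (fne _ _ ab) (fne _ _ ac) (fne _ _ bc));
  rewrite ?h1 ?h2.
Qed.

Lemma moebius_inverse (f : boundary X -> boundary X')
    (g : boundary X' -> boundary X) : moebius_embedding f -> cancel g f ->
  moebius_embedding g.
Proof.
move=> [finj fcrt] gf; split; first exact: can_inj gf.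
move=> x' x a b c e [h1 h2 h3 h4]; rewrite -(fcrt x x') ?gf //.
by split=> -[/(can_inj gf) e1 /(can_inj gf) e2];
  [apply: h1 | apply: h2 | apply: h3 | apply: h4].
Qed.

End Moebius.

Unset Implicit Arguments.

Theorem theorem4p3 (R : realType) (X X' : metricType R)
    (hX : is_tree X) (hXc : geodesically_complete X) (hX3 : nonelementary X)
    (hX' : is_tree X') (hX'3 : nonelementary X')
    (f : boundary X -> boundary X') (hf : moebius_embedding f) :
  (exists! F : X -> X', isometric_embedding F /\ boundary_extension F f) /\
  (set_surj [set: boundary X] [set: boundary X'] f ->
   geodesically_complete X' ->
   forall F : X -> X', isometric_embedding F -> boundary_extension F f ->
     is_isometry F).
Proof.
have finj := hf.1; split.
  have [F hF] := choice (fun x => moebius_point hX hX' x hXc hX3 hf).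
  have isoF := bgp_compatible_isometric hX hX' hXc hX3 finj hF.
  exists F; split; first split=> //.
    exact: (bgp_compatible_extension hX hX' hXc hX3 finj hF).
  move=> F' [isoF' extF']; apply/funext => x.
  have hF' := isometric_extension_compatible hX hX' finj isoF' extF'.
  exact: (bgp_ext_eq hX hX' hXc hX3 finj (hF x) (hF' x)).
move=> surj hX'c F isoF extF; split=> // x' _.
have hF := isometric_extension_compatible hX hX' finj isoF extF.
have /choice[g gf] : forall b' : boundary X', exists b, f b = b'.
  by move=> b'; have [b _ fb] := surj b' I; exists b.
have ginj := can_inj gf.
(* the point of [X] that [x'] is sent to by the inverse of [f] *)
have [x hx] := moebius_point hX' hX x' hX'c hX'3 (moebius_inverse hf gf).
exists x => //.
have [a [b [ab xab]]] := line_through hX' hX'c x' hX'3.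
have E d e : d <> e -> bgp (F x) d e = bgp x' d e.
  by move=> de; rewrite -{1}(gf d) -{1}(gf e) hF ?hx // => /ginj.
have [c ac bc] := boundary_third a b hX'3.
by apply: (bgp_point_uniq hX' ab ac bc); rewrite ?E.
Qed.
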